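(* Consider an $S_1S_0$ subgame, i.e. $\varphi_1+\varphi_2=1$, with $0<D<\sum_i y_i^*(\bar p,\varphi_i)$, and let $l_1=l_2=l$ be the common lower support of the mixed price equilibrium. Then the suppliers' mixed equilibrium price strategies are characterized by the following CDFs $F_i^e$ on $l\le p<\bar p$: - if $\varphi_i=1$, $$F_i^e(p)=\frac{\pi_{-i}^R\big(p,\min(y_{-i}^*(p,\varphi_{-i}),D),\boldsymbol\varphi\big)-\pi_{-i}^{RE}(\boldsymbol\varphi)}{\pi_{-i}^R\big(p,\min(y_{-i}^*(p,\varphi_{-i}),D),\boldsymbol\varphi\big)-\pi_{-i}^R\big(p,(D-\mathbb E[X_i])^+,\boldsymbol\varphi\big)};$$ - if $\varphi_i=0$, $$F_i^e(p)=\int_l^{p}\frac{\pi_{-i}^{RE}(\boldsymbol\varphi)}{q^2\min\big(y_i^*(q,\varphi_i),D\big)-q^2\,(D-\mathbb E[X_{-i}])^+}\,dq.$$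
   Context: There are two suppliers $i\in\{1,2\}$; $-i$ denotes the other supplier. Constants: demand $D>0$, price cap $\bar p>0$, penalty price $\lambda>\bar p$. Supplier $i$'s renewable generation is a random variable $X_i$ bounded in $[0,\bar X_i]$ with continuous CDF $F_i$ and density $f_i$; $F_i$ is invertible on $[0,\bar X_i]$, with inverse $F_i^{-1}$ and $F_i^{-1}(0)=0$. $\varphi_i=1$ means supplier $i$ invests in storage, $\varphi_i=0$ that he does not. Each supplier bids a price $p_i\in[0,\bar p]$; his bidding quantity is $y_i^*(p_i,\varphi_i)=\mathbb E[X_i]$ if $\varphi_i=1$ and $y_i^*(p_i,\varphi_i)=F_i^{-1}(p_i/\lambda)$ if $\varphi_i=0$; write $\boldsymbol y^*(\boldsymbol p)$ for the pair. Consumers' purchase: if $p_i<p_{-i}$, then $x_i^*(\boldsymbol p,\boldsymbol y)=\min(D,y_i)$ and $x_{-i}^*(\boldsymbol p,\boldsymbol y)=\min(D-\min(D,y_i),\,y_{-i})$. If $p_1=p_2$, the demand is allocated according to the rule for either $p_1<p_2$ or $p_2<p_1$, the choice being made so as to maximize the two suppliers' total revenue (with equal probabilities if there is no difference). Revenue, with $(g)^+=\max(g,0)$: $\pi_i^R(p_i,x,\boldsymbol\varphi)=p_ix-\lambda(x-\mathbb E[X_i])^+$ if $\varphi_i=1$, and $\pi_i^R(p_i,x,\boldsymbol\varphi)=p_ix-\lambda\mathbb E[(x-X_i)^+]$ if $\varphi_i=0$. A mixed price equilibrium is a pair $(\mu_1^*,\mu_2^* )$ of probability measures on $[0,\bar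 p]$ such that, for both $i$, the expected revenue $\int\pi_i^R(p_i,x_i^*(\boldsymbol p,\boldsymbol y^*(\boldsymbol p)),\boldsymbol\varphi)\,d(\mu_i\times\mu_{-i}^* )(\boldsymbol p)$ is maximized over probability measures $\mu_i$ at $\mu_i=\mu_i^*$; the maximum is the equilibrium revenue $\pi_i^{RE}(\boldsymbol\varphi)$. $F_i^e$ is the CDF of $\mu_i^*$, $u_i=\inf\{p:F_i^e(p)=1\}$ its upper support and $l_i=\sup\{p:F_i^e(p)=0\}$ its lower support. Properties of the mixed price equilibrium taken as given (when $0<D<\sum_iy_i^*(\bar p,\varphi_i)$ and $\varphi_1+\varphi_2=1$, no pure price equilibrium exists): a mixed price equilibrium exists; $l_1=l_2=l>0$ and $u_1=u_2=\bar p$; $\pi_i^{RE}(\boldsymbol\varphi)=\pi_i^R(l,\min(D,y_i^*(l,\varphi_i)),\boldsymbol\varphi)$; each $F_i^e$ is strictly increasing on $[l,\bar p]$ with no atoms on $[l,\bar p)$, and $F_1^e,F_2^e$ do not both have an atom at $\bar p$. *)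

(* Defs.v *)
From HB Require Import structures.
From mathcomp Require Export all_boot all_order all_algebra.
From mathcomp Require Export all_classical all_reals all_analysis.

Set Implicit Arguments.
Unset Strict Implicit.
Unset Printing Implicit Defensive.
Import Order.TTheory GRing.Theory Num.Theory.
Import numFieldNormedType.Exports.
Local Open Scope classical_set_scope.
Local Open Scope ring_scope.

(* The two suppliers are the two booleans, so that the competitor of i is ~~ i.
   Nothing depends on which boolean stands for which supplier. *)
Notation supplier := bool (only parsing).

(* The joint law of the two generations plays no role: only the marginals of
   [generation] are constrained, and no independence is assumed. *)
Record market (R : realType) (d : measure_display) (T : measurableType d)
    (P : probability T R) := Market {
  demand : R;
  price_cap : R;
  penalty : R;
  generation : supplier -> {RV P >-> R};
  max_generation : supplier -> R;
  density : supplier -> R -> R;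
  inv_cdf : supplier -> R -> R;
  demand_gt0 : 0 < demand;
  price_cap_gt0 : 0 < price_cap;
  price_cap_lt_penalty : price_cap < penalty;
  generation_bounded : forall i,
    {ae P, forall t, 0 <= generation i t <= max_generation i};
  gen_cdf_continuous : forall i,
    continuous (fun x : R => fine (cdf (generation i) x));
  density_measurable : forall i, measurable_fun setT (density i);
  density_ge0 : forall i x, 0 <= density i x;
  densityE : forall i x,
    cdf (generation i) x =
    (\int[lebesgue_measure]_(t in `]-oo, x]) (density i t)%:E)%E;
  (* [inv_cdf i] is only meaningful on [0, 1]. *)
  inv_cdf_itv : forall i u,
    u \in `[0, 1] -> inv_cdf i u \in `[0, max_generation i];
  gen_cdfK : forall i, {in `[0, max_generation i],
    cancel (fun x => fine (cdf (generation i) x)) (inv_cdf i)};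
  inv_cdfK : forall i, {in `[0, 1],
    cancel (inv_cdf i) (fun x => fine (cdf (generation i) x))};
  inv_cdf0 : forall i, inv_cdf i 0 = 0
}.

Section Subgame.
Variables (R : realType) (d : measure_display) (T : measurableType d).
Variables (P : probability T R) (M : market P).
Variable phi : supplier -> bool.

Definition mean_generation (i : supplier) : R :=
  fine ('E_P[generation M i])%E.

Definition bid_quantity (i : supplier) (p : R) : R :=
  if phi i then mean_generation i else inv_cdf M i (p / penalty M).

Definition revenue (i : supplier) (p x : R) : R :=
  if phi i
  then p * x - penalty M * Num.max (x - mean_generation i) 0
  else p * x -
    penalty M * fine ('E_P[fun t => Num.max (x - generation M i t)%R 0%R])%E.

(* Quantity bought from i when k is served first, y being the bid quantities. *)
Definition purchase (k : supplier) (y : supplier -> R) (i : supplier) : R :=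
  if i == k then Num.min (demand M) (y i)
  else Num.min (demand M - Num.min (demand M) (y k)) (y i).

Definition order_revenue (k : supplier) (p : supplier -> R) (i : supplier) : R :=
  revenue i (p i) (purchase k (fun j => bid_quantity j (p j)) i).

Definition total_revenue (k : supplier) (p : supplier -> R) : R :=
  \sum_(i : supplier) order_revenue k p i.

(* Probability that k is served first at the price profile p. *)
Definition first_prob (p : supplier -> R) (k : supplier) : R :=
  if p k < p (~~ k) then 1
  else if p (~~ k) < p k then 0
  else if total_revenue (~~ k) p < total_revenue k p then 1
  else if total_revenue k p < total_revenue (~~ k) p then 0
  else 2^-1.

Definition payoff (i : supplier) (p : supplier -> R) : R :=
  \sum_(k : supplier) first_prob p k * order_revenue k p i.

(* Supplier i plays mu and the competitor plays nu. Since [inv_cdf] is arbitrary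
   outside [0, 1], the integral is restricted to admissible prices. *)
Definition expected_revenue (i : supplier) (mu nu : probability R R) : \bar R :=
  (\int[mu \x nu]_(z in `[0%R, price_cap M] `*` `[0%R, price_cap M])
     (payoff i (fun j => if j == i then z.1 else z.2))%:E)%E.

Definition price_strategy (mu : probability R R) : Prop :=
  mu `[0, price_cap M]%classic = 1%E.

Definition mixed_price_equilibrium (mu : supplier -> probability R R) : Prop :=
  (forall i, price_strategy (mu i)) /\
  (forall i (nu : probability R R), price_strategy nu ->
    (expected_revenue i nu (mu (~~ i)) <=
     expected_revenue i (mu i) (mu (~~ i)))%E).

Definition equilibrium_revenue (mu : supplier -> probability R R)
    (i : supplier) : R :=
  fine (expected_revenue i (mu i) (mu (~~ i))).

End Subgame.

Section PriceDistribution.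
Variables (R : realType) (mu : probability R R).

Definition price_cdf (p : R) : R := fine (mu `]-oo, p]%classic).

Definition upper_support : R := inf [set p | price_cdf p = 1].

Definition lower_support : R := sup [set p | price_cdf p = 0].

End PriceDistribution.

(* Main.v *)
(* A deviation to a pure price shows that no price earns a supplier more than
   the equilibrium revenue, and undercutting by a small amount costs little, so
   every price in [l, cap[ earns exactly the equilibrium revenue. Against the
   supplier with storage, whose quantity does not depend on his price, this
   indifference is a linear equation in his CDF, solvable because the revenue of
   the first served strictly increases with the price. For the CDF N of the
   supplier without storage, comparing two prices a < b gives
     k(a) (N(b) - N(a)) <= C / a - C / b <= k(b) (N(b) - N(a)),
   where C is the equilibrium revenue of the competitor and k(q) is the demand
   that the competitor loses to an opponent bidding q. As k is continuous,
   N' = C / (q^2 k) inside the support. *)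

Require Import Defs.
From mathcomp Require Import measurable_realfun ring lra.
Import Order.TTheory GRing.Theory Num.Theory.
Import numFieldNormedType.Exports.
Local Open Scope classical_set_scope.
Local Open Scope ring_scope.
Set Implicit Arguments.
Unset Strict Implicit.
Unset Printing Implicit Defensive.

(** * Expected shortfall of the generation below a sold quantity *)

Section Excess.
Context d (T : measurableType d) (R : realType) (P : probability T R).
Variable X : {RV P >-> R}.
Hypothesis X_ge0 : {ae P, forall t, 0 <= X t}.

Definition excess (x : R) : R :=
  fine ('E_P[fun t => Num.max (x - X t)%R 0%R])%E.

Lemma measurable_excess_fun x :
  measurable_fun setT (fun t => Num.max (x - X t) 0).
Proof. by apply: measurable_maxr => //; exact: measurable_funB. Qed.

(** The shortfall lies between 0 and |x| almost everywhere, so its expectation is finite and [fine]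
    loses nothing. *)
Lemma expectation_excess x :
  ('E_P[fun t => Num.max (x - X t)%R 0%R] = (excess x)%:E)%E.
Proof.
rewrite /excess fineK// unlock ge0_fin_numE; last first.
  by apply: integral_ge0 => t _; rewrite lee_fin le_max lexx orbT.
have Xx : {ae P, forall t,
    setT t -> ((Num.max (x - X t)%R 0%R)%:E <= `|x|%:E)%E}.
  apply: filterS X_ge0 => t Xt _; rewrite lee_fin ge_max normr_ge0 andbT.
  by rewrite (le_trans _ (ler_norm x))// lerBlDr lerDl.
apply: (@le_lt_trans _ _ (\int[P]_t `|x|%:E)%E).
  apply: ae_ge0_le_integral => //.
  - by move=> t _; rewrite lee_fin le_max lexx orbT.
  - by apply/measurable_EFinP; exact: measurable_excess_fun.
by rewrite integral_cst//= probability_setT mule1 ltry.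
Qed.

Lemma excess_ge0 x : 0 <= excess x.
Proof.
rewrite -lee_fin -expectation_excess unlock; apply: integral_ge0 => t _.
by rewrite lee_fin le_max lexx orbT.
Qed.

Lemma excess0 : excess 0 = 0.
Proof.
apply/EFin_inj; rewrite -expectation_excess unlock.
have X0 : ae_eq P setT (fun t => (Num.max (0 - X t) 0)%:E) (cst 0%E).
  apply: filterS X_ge0 => t Xt _ /=; congr EFin.
  by apply/max_idPr; rewrite sub0r oppr_le0.
rewrite (@ge0_ae_eq_integral _ _ _ P setT _ (cst 0%E)) ?integral0//.
- by apply/measurable_EFinP; exact: measurable_excess_fun.
- by move=> t _; rewrite lee_fin le_max lexx orbT.
Qed.

Let indic_leE x t : \1_(X @^-1` `]-oo, x]) t = ((X t <= x)%R)%:R :> R.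
Proof.
rewrite indicE; congr ((nat_of_bool _)%:R).
by apply/idP/idP; rewrite inE /= in_itv.
Qed.

Let integral_step x c : 0 <= c ->
  (\int[P]_t (c * \1_(X @^-1` `]-oo, x]) t)%:E = (c * fine (cdf X x))%:E)%E.
Proof.
move=> c0.
have mA : measurable (X @^-1` `]-oo, x]).
  by rewrite -[X in measurable X]setTI; exact: measurable_funP.
under eq_integral do rewrite EFinM.
rewrite ge0_integralZl//=; last first.
  by apply/measurable_EFinP; exact: measurable_indic.
rewrite integral_indic// setIT EFinM fineK ?fin_num_measure//.
Qed.

Let integral_excessD x y c : 0 <= c ->
  (\int[P]_t (Num.max (x - X t) 0 + c * \1_(X @^-1` `]-oo, y]) t)%:E
   = (excess x + c * fine (cdf X y))%:E)%E.
Proof.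
move=> c0; have mA : measurable (X @^-1` `]-oo, y]).
  by rewrite -[X in measurable X]setTI; exact: measurable_funP.
under eq_integral do rewrite EFinD.
rewrite ge0_integralD//=; last first.
- by apply/measurable_EFinP/measurable_funM => //; exact: measurable_indic.
- by move=> t _; rewrite lee_fin mulr_ge0.
- by apply/measurable_EFinP; exact: measurable_excess_fun.
- by move=> t _; rewrite lee_fin le_max lexx orbT.
by rewrite integral_step// EFinD -expectation_excess unlock.
Qed.

(** Pointwise, selling y instead of x adds at most y - x to the shortfall, and only on the event X
    <= y. *)
Lemma excess_le x y : x <= y ->
  excess y <= excess x + (y - x) * fine (cdf X y).
Proof.
move=> xy; have c0 : 0 <= y - x by rewrite subr_ge0.
have mA : measurable (X @^-1` `]-oo, y]).
  by rewrite -[X in measurable X]setTI; exact: measurable_funP.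
rewrite -lee_fin -integral_excessD// -expectation_excess unlock.
apply: ge0_le_integral => //.
- by move=> t _; rewrite lee_fin le_max lexx orbT.
- by apply/measurable_EFinP; exact: measurable_excess_fun.
- apply/measurable_EFinP/measurable_funD; first exact: measurable_excess_fun.
  by apply: measurable_funM => //; exact: measurable_indic.
move=> t _; rewrite lee_fin indic_leE.
by case: (leP (X t) y) => Xy /=; rewrite !maxEle;
  do 2 case: ifPn; rewrite -?ltNge; lra.
Qed.

(** On the event X <= x the shortfall grows by exactly y - x, and elsewhere it does not shrink. *)
Lemma excess_ge x y : x <= y ->
  excess x + (y - x) * fine (cdf X x) <= excess y.
Proof.
move=> xy; have c0 : 0 <= y - x by rewrite subr_ge0.
have mA : measurable (X @^-1` `]-oo, x]).
  by rewrite -[X in measurable X]setTI; exact: measurable_funP.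
rewrite -lee_fin -integral_excessD// -expectation_excess unlock.
apply: ge0_le_integral => //.
- by move=> t _; rewrite lee_fin addr_ge0 ?mulr_ge0// le_max lexx orbT.
- apply/measurable_EFinP/measurable_funD; first exact: measurable_excess_fun.
  by apply: measurable_funM => //; exact: measurable_indic.
- by apply/measurable_EFinP; exact: measurable_excess_fun.
move=> t _; rewrite lee_fin indic_leE.
by case: (leP (X t) x) => Xx /=; rewrite !maxEle;
  do 2 case: ifPn; rewrite -?ltNge; lra.
Qed.

End Excess.

(** * Bids, revenues and payoffs at given prices *)

Section Bidding.
Context (R : realType) d (T : measurableType d) (P : probability T R).
Variables (M : market P) (phi : supplier -> bool).
Implicit Types (i : supplier) (p q c x : R).

Lemma generation_ge0 i : {ae P, forall t, 0 <= generation M i t}.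
Proof. by apply: filterS (generation_bounded M i) => t /andP[]. Qed.

Lemma mean_generation_ge0 i : 0 <= mean_generation M i.
Proof.
rewrite /mean_generation unlock; apply: fine_ge0.
(* The generation is nonnegative only almost everywhere; its positive part is so everywhere. *)
have X0 : ae_eq P setT (fun t => (generation M i t)%:E)
                       (fun t => (Num.max (generation M i t) 0)%:E).
  apply: filterS (generation_ge0 i) => t Xt _ /=; congr EFin.
  exact/esym/max_idPl.
rewrite (ae_eq_integral (fun t => (Num.max (generation M i t) 0)%:E)
  _ measurableT _ _ X0)//; last 2 first.
- by apply/measurable_EFinP.
- by apply/measurable_EFinP; exact: measurable_maxr.
by apply: integral_ge0 => t _; rewrite lee_fin le_max lexx orbT.
Qed.

(** Applying the nondecreasing CDF to inv_cdf v <= inv_cdf u would give v <= u. *)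
Lemma inv_cdf_incr i : {in `[0, 1] &, {homo inv_cdf M i : u v / u < v}}.
Proof.
move=> u v u01 v01 uv; rewrite ltNge; apply/negP => vu.
have := fine_le _ _ (cdf_nondecreasing (generation M i) vu).
rewrite !fin_num_measure// => /(_ isT isT).
by rewrite (inv_cdfK M i v01) (inv_cdfK M i u01) leNgt uv.
Qed.

Lemma penalty_gt0 : 0 < penalty M.
Proof. exact: lt_trans (price_cap_gt0 M) (price_cap_lt_penalty M). Qed.

Lemma price_ratio_itv p : 0 <= p <= price_cap M -> p / penalty M \in `[0, 1].
Proof.
move=> /andP[p0 pc]; rewrite in_itv /= divr_ge0 ?(ltW penalty_gt0)//=.
rewrite ler_pdivrMr ?penalty_gt0// mul1r.
exact: le_trans pc (ltW (price_cap_lt_penalty M)).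
Qed.

Notation bid := (bid_quantity M phi).

Lemma bid_ge0 i p : 0 <= p <= price_cap M -> 0 <= bid i p.
Proof.
move=> pc; rewrite /bid_quantity; case: ifP => _.
  exact: mean_generation_ge0.
by have := inv_cdf_itv M i (price_ratio_itv pc); rewrite in_itv /= => /andP[].
Qed.

Lemma bid_incr i p q : phi i = false -> 0 <= p -> q <= price_cap M ->
  p < q -> bid i p < bid i q.
Proof.
move=> phii p0 qc pq; rewrite /bid_quantity phii.
apply: inv_cdf_incr; rewrite ?price_ratio_itv ?p0 ?qc ?(le_trans _ qc) ?ltW//.
  by rewrite (le_lt_trans p0).
by rewrite ltr_pM2r ?invr_gt0 ?penalty_gt0.
Qed.

Lemma bid_nondecreasing i p q : 0 <= p -> q <= price_cap M ->
  p <= q -> bid i p <= bid i q.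
Proof.
move=> p0 qc; rewrite le_eqVlt => /predU1P[->//|pq].
case phii : (phi i); first by rewrite /bid_quantity phii.
exact/ltW/bid_incr.
Qed.

Lemma cdf_bid i p : phi i = false -> 0 <= p <= price_cap M ->
  penalty M * fine (cdf (generation M i) (bid i p)) = p.
Proof.
move=> phii pc; rewrite /bid_quantity phii (inv_cdfK M i (price_ratio_itv pc)).
by rewrite mulrC divfK// gt_eqF ?penalty_gt0.
Qed.

Lemma revenue_unstored i p x : phi i = false ->
  revenue M phi i p x = p * x - penalty M * excess (generation M i) x.
Proof. by move=> phii; rewrite /revenue phii. Qed.

(* The marginal revenue p - penalty * F(x) changes sign at the bid quantity. *)
Lemma revenue_incr i p x1 x2 : phi i = false -> 0 <= p <= price_cap M ->
  x1 <= x2 -> x2 <= bid i p -> revenue M phi i p x1 <= revenue M phi i p x2.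
Proof.
move=> phii pc x12 x2y; rewrite !revenue_unstored//.
have := excess_le (generation_ge0 i) x12.
have := fine_le _ _ (cdf_nondecreasing (generation M i) x2y).
rewrite !fin_num_measure// => /(_ isT isT).
have := cdf_bid phii pc; have := penalty_gt0; move: (penalty M) => lam.
set Fy := fine _; set F := fine _ => lam0 lFy FFy Ex.
have : (x2 - x1) * (lam * F) <= (x2 - x1) * p.
  by rewrite ler_wpM2l ?subr_ge0// -lFy ler_wpM2l ?(ltW lam0).
have : lam * excess (generation M i) x2 <=
    lam * (excess (generation M i) x1 + (x2 - x1) * F).
  by rewrite ler_wpM2l ?(ltW lam0).
lra.
Qed.

Lemma revenue_decr i p x1 x2 : phi i = false -> 0 <= p <= price_cap M ->
  bid i p <= x1 -> x1 <= x2 -> revenue M phi i p x2 <= revenue M phi i p x1.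
Proof.
move=> phii pc yx1 x12; rewrite !revenue_unstored//.
have := excess_ge (generation_ge0 i) x12.
have := fine_le _ _ (cdf_nondecreasing (generation M i) yx1).
rewrite !fin_num_measure// => /(_ isT isT).
have := cdf_bid phii pc; have := penalty_gt0; move: (penalty M) => lam.
set Fy := fine _; set F := fine _ => lam0 lFy FFy Ex.
have : (x2 - x1) * p <= (x2 - x1) * (lam * F).
  by rewrite ler_wpM2l ?subr_ge0// -lFy ler_wpM2l ?(ltW lam0).
have : lam * (excess (generation M i) x1 + (x2 - x1) * F) <=
    lam * excess (generation M i) x2.
  by rewrite ler_wpM2l ?(ltW lam0).
lra.
Qed.

(** Revenue of i when the demand within his reach is c: he sells it up to his bid. Served first he
    has c = [demand M]; served second, c is what the competitor leaves. *)
Definition capped_revenue i p c : R := revenue M phi i p (Num.min c (bid i p)).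

(** The sale never exceeds the mean generation, so the penalty vanishes. *)
Lemma capped_revenue_stored i p c : phi i = true ->
  capped_revenue i p c = p * Num.min c (mean_generation M i).
Proof.
move=> phii; rewrite /capped_revenue /revenue /bid_quantity phii.
rewrite [X in _ - _ * X](max_idPr _) ?mulr0 ?subr0//.
by rewrite subr_le0 ge_min lexx orbT.
Qed.

Lemma capped_revenue_nondecreasing i p c c' : 0 <= p <= price_cap M ->
  c <= c' -> capped_revenue i p c <= capped_revenue i p c'.
Proof.
move=> pc cc'; case phii : (phi i).
  rewrite !capped_revenue_stored// ler_wpM2l//; first by case/andP: pc.
  by rewrite le_min !ge_min cc' lexx orbT.
apply: revenue_incr => //; last by rewrite ge_min lexx orbT.
by rewrite le_min !ge_min cc' lexx orbT.
Qed.

Lemma capped_revenue0 i p : 0 <= p <= price_cap M -> capped_revenue i p 0 = 0.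
Proof.
move=> pc; rewrite /capped_revenue (min_idPl _) ?bid_ge0//.
case phii : (phi i).
  rewrite /revenue phii mulr0 sub0r (max_idPr _) ?mulr0 ?oppr0//.
  by rewrite sub0r oppr_le0 mean_generation_ge0.
by rewrite revenue_unstored// excess0 ?mulr0 ?subr0//; exact: generation_ge0.
Qed.

Lemma capped_revenue_ge0 i p c : 0 <= p <= price_cap M -> 0 <= c ->
  0 <= capped_revenue i p c.
Proof.
by move=> pc c0; rewrite -(capped_revenue0 i pc) capped_revenue_nondecreasing.
Qed.

(** The sale made at p stays within the bid at q. Keeping it at the price q gains q - p per unit,
    and selling up to the new cap is at least as good. *)
Lemma capped_revenue_ge i p q c : 0 <= p -> q <= price_cap M -> p <= q ->
  capped_revenue i p c + (q - p) * Num.min c (bid i p) <= capped_revenue i q c.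
Proof.
move=> p0 qc pq; have := bid_nondecreasing i p0 qc pq.
case phii : (phi i) => bpq.
  by rewrite !capped_revenue_stored// /bid_quantity phii -mulrDl addrC subrK.
have minpq : Num.min c (bid i p) <= Num.min c (bid i q).
  by rewrite le_min !ge_min bpq lexx orbT.
have rev_le : revenue M phi i q (Num.min c (bid i p)) <= capped_revenue i q c.
  apply: revenue_incr => //; first by rewrite (le_trans p0).
  by rewrite ge_min lexx orbT.
by apply: le_trans rev_le; rewrite /capped_revenue !revenue_unstored//; lra.
Qed.

(** Repricing the sale made at q down to p loses q - p on at most c units. If that sale exceeds the
    bid at p, cutting it down to the bid does not hurt. *)
Lemma capped_revenue_le i p q c : 0 <= p -> q <= price_cap M -> p <= q ->
  capped_revenue i q c <= capped_revenue i p c + (q - p) * c.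
Proof.
move=> p0 qc pq; have := bid_nondecreasing i p0 qc pq.
have min_c x : Num.min c x <= c by rewrite ge_min lexx.
have qp0 : 0 <= q - p by rewrite subr_ge0.
case phii : (phi i) => bpq.
  rewrite !capped_revenue_stored//.
  have := ler_wpM2l qp0 (min_c (mean_generation M i)); lra.
have rev_le : revenue M phi i p (Num.min c (bid i q)) <= capped_revenue i p c.
  rewrite /capped_revenue; have [cy|yc] := leP c (bid i p).
    by rewrite (min_idPl (le_trans cy bpq)).
  apply: revenue_decr => //; first by rewrite p0 (le_trans pq).
  by rewrite le_min ltW.
apply: le_trans (lerD rev_le (ler_wpM2l qp0 (min_c (bid i q)))).
by rewrite /capped_revenue !revenue_unstored//; lra.
Qed.

(** Since p > 0, the bid at p exceeds the bid at 0, so the price increase is earned on a positive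
    sale. *)
Lemma capped_revenue_incr i p q c : phi i = false -> 0 < p ->
  q <= price_cap M -> p < q -> 0 < c ->
  capped_revenue i p c < capped_revenue i q c.
Proof.
move=> phii p0 qc pq c0.
apply: lt_le_trans (capped_revenue_ge i c (ltW p0) qc (ltW pq)).
rewrite ltrDl mulr_gt0 ?subr_gt0// lt_min c0.
apply: le_lt_trans (bid_incr phii _ (le_trans (ltW pq) qc) p0) => //.
by apply: bid_ge0; rewrite lexx ltW ?price_cap_gt0.
Qed.

(** The demand left to the competitor when i is served first. *)
Definition residual_demand i p : R := demand M - Num.min (demand M) (bid i p).

Lemma residual_demand_ge0 i p : 0 <= residual_demand i p.
Proof. by rewrite subr_ge0 ge_min lexx. Qed.

Lemma residual_demand_le i p : 0 <= p <= price_cap M ->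
  residual_demand i p <= demand M.
Proof. by move=> pc; rewrite gerBl le_min bid_ge0// ltW ?demand_gt0. Qed.

(** Payoff of i pricing x against z, with the profile written as in [expected_revenue]. *)
Definition duel i x z : R := payoff M phi i (fun j => if j == i then x else z).

Lemma duel_lt i x z : x < z -> duel i x z = capped_revenue i x (demand M).
Proof.
move=> xz; have zx := lt_gtF xz; rewrite /duel /payoff big_bool /first_prob.
by case: i => /=; rewrite xz zx ?mul0r ?addr0 ?add0r mul1r.
Qed.

Lemma duel_gt i x z : z < x ->
  duel i x z = capped_revenue i x (residual_demand (~~ i) z).
Proof.
move=> zx; have xz := lt_gtF zx; rewrite /duel /payoff big_bool /first_prob.
by case: i => /=; rewrite xz zx ?mul0r ?addr0 ?add0r mul1r.
Qed.

(** The weight w is the probability that i is served first; at a tie the probabilities of the two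
    orders add up to 1. *)
Lemma duel_tie i x : exists2 w, 0 <= w <= 1 &
  duel i x x = w * capped_revenue i x (demand M) +
               (1 - w) * capped_revenue i x (residual_demand (~~ i) x).
Proof.
exists (first_prob M phi (fun=> x) i).
  rewrite /first_prob ltxx; case: (_ < _); first by rewrite ler01 lexx.
  case: (_ < _); first by rewrite lexx ler01.
  by rewrite invr_ge0 invf_le1 ?ler0n ?ler1n ?ltr0n.
have first_probN : first_prob M phi (fun=> x) (~~ i) =
    1 - first_prob M phi (fun=> x) i.
  rewrite /first_prob ltxx negbK.
  case: (ltgtP (total_revenue _ _ i _)) => _; rewrite ?subrr ?subr0//.
  lra.
rewrite /duel /payoff big_bool -first_probN.
have -> : (fun j => if j == i then x else x) = fun=> x.
  by apply/funext => j; case: ifP.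
by case: i first_probN => _ //=; rewrite addrC.
Qed.

Lemma duel_itv i x z : 0 <= x <= price_cap M -> 0 <= z <= price_cap M ->
  capped_revenue i x (residual_demand (~~ i) z) <= duel i x z
    <= capped_revenue i x (demand M).
Proof.
move=> xc zc.
have le12 : capped_revenue i x (residual_demand (~~ i) z) <=
    capped_revenue i x (demand M).
  by rewrite capped_revenue_nondecreasing// residual_demand_le.
have [xz|zx|xz] := ltgtP x z.
- by rewrite duel_lt// le12 lexx.
- by rewrite duel_gt// le12 lexx.
subst z; have [w /andP[w0 w1] ->] := duel_tie i x; nra.
Qed.

Lemma duel_ge0 i x z : 0 <= x <= price_cap M -> 0 <= z <= price_cap M ->
  0 <= duel i x z.
Proof.
move=> xc zc; have /andP[+ _] := duel_itv i xc zc; apply: le_trans.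
by rewrite capped_revenue_ge0// residual_demand_ge0.
Qed.

Lemma duel_le i x z : 0 <= x <= price_cap M -> 0 <= z <= price_cap M ->
  duel i x z <= price_cap M * demand M.
Proof.
move=> xc zc; have /andP[_ /le_trans] := duel_itv i xc zc; apply.
have /andP[x0 xcap] := xc.
have := capped_revenue_le i (demand M) (lexx 0) xcap x0.
(* At the price 0 nothing is earned and only a penalty can remain. *)
have : capped_revenue i 0 (demand M) <= 0.
  case phii : (phi i); first by rewrite capped_revenue_stored// mul0r.
  rewrite /capped_revenue revenue_unstored// mul0r sub0r oppr_le0.
  by rewrite mulr_ge0 ?(ltW penalty_gt0)//; exact/excess_ge0/generation_ge0.
have : x * demand M <= price_cap M * demand M.
  by rewrite (ler_wpM2r (ltW (demand_gt0 M))).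
lra.
Qed.

(* Undercutting slightly costs little: the price loss is at most proportional
   to the undercut, and being served first is worth more than being second. *)
Lemma duel_undercut i p x z : 0 <= p -> p < x -> x <= price_cap M ->
  0 <= z <= price_cap M -> z != p ->
  duel i x z <= duel i p z + (x - p) * demand M.
Proof.
move=> p0 px xc zc zp.
have x0 := le_trans p0 (ltW px).
have xp0 : 0 <= x - p by rewrite subr_ge0 ltW.
have xi : 0 <= x <= price_cap M by rewrite x0.
(* If z < p, both prices are served second. If p < z, the price p is served first, and x earns at
   most what it would earn when served first. *)
have [zltp|pz|/eqP] := ltgtP z p; last by rewrite (negbTE zp).
  rewrite duel_gt ?(lt_trans zltp)// duel_gt//.
  apply: le_trans (capped_revenue_le _ _ p0 xc (ltW px)) _.
  by rewrite lerD2l ler_wpM2l// residual_demand_le.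
rewrite (duel_lt _ pz).
apply: le_trans (capped_revenue_le _ _ p0 xc (ltW px)).
by have /andP[] := duel_itv i xi zc.
Qed.

End Bidding.

(** * Integrals of bounded functions against a probability measure *)

Section BoundedIntegral.
Context d (T : measurableType d) (R : realType) (m : probability T R).
Implicit Types (f g : T -> R) (N : set T).

(** A condition that implies integrability and is preserved by sums and affine images, so that it
    can be checked compositionally. *)
Definition bounded_measurable f :=
  measurable_fun setT f /\ exists c, forall t, `|f t| <= c.

Lemma integrable_bounded_measurable f : bounded_measurable f ->
  m.-integrable setT (EFin \o f).
Proof.
move=> [mf [c fc]].
apply: (le_integrable measurableT (g := EFin \o cst `|c|)).
- exact/measurable_EFinP.
- move=> t _ /=; rewrite lee_fin normr_id.
  exact: le_trans (fc t) (ler_norm c).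
- exact: finite_measure_integrable_cst.
Qed.

Lemma bounded_measurable_affine f a b : bounded_measurable f ->
  bounded_measurable (fun t => f t * a + b).
Proof.
move=> [mf [c fc]]; split.
  by apply: measurable_funD => //; exact: measurable_funM.
exists (c * `|a| + `|b|) => t; apply: le_trans (ler_normD _ _) _.
by rewrite lerD2r normrM ler_wpM2r.
Qed.

Lemma bounded_measurable_indic A : measurable A ->
  bounded_measurable (\1_A : T -> R).
Proof.
move=> mA; split; first exact: measurable_indic.
by exists 1 => t; rewrite indicE; case: (_ \in _); rewrite ?normr1 ?normr0.
Qed.

Lemma bounded_measurableD f g : bounded_measurable f -> bounded_measurable g ->
  bounded_measurable (fun t => f t + g t).
Proof.
move=> [mf [c fc]] [mg [e ge]]; split; first exact: measurable_funD.
exists (c + e) => t; exact: le_trans (ler_normD _ _) (lerD (fc t) (ge t)).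
Qed.

Lemma Rintegral_affine f a b : bounded_measurable f ->
  \int[m]_t (f t * a + b) = \int[m]_t f t * a + b.
Proof.
move=> bf; have bfa := bounded_measurable_affine a 0 bf.
rewrite RintegralD//.
- rewrite RintegralZr//; last exact: integrable_bounded_measurable.
  by rewrite Rintegral_cst//= probability_setT mulr1.
- move: (integrable_bounded_measurable bfa).
  by apply: eq_integrable => // t _ /=; rewrite addr0.
- exact: finite_measure_integrable_cst.
Qed.

Lemma Rintegral_add f g : bounded_measurable f -> bounded_measurable g ->
  \int[m]_t (f t + g t) = \int[m]_t f t + \int[m]_t g t.
Proof.
by move=> bf bg; rewrite RintegralD//; exact: integrable_bounded_measurable.
Qed.

Lemma Rintegral_indic A : measurable A -> \int[m]_t \1_A t = fine (m A).
Proof. by move=> mA; rewrite /Rintegral integral_indic// setIT. Qed.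

(** Allows payoffs to be compared only at opponent prices that are admissible and cause no tie. *)
Lemma le_Rintegral_off_null f g N : measurable N -> m N = 0%E ->
  bounded_measurable f -> bounded_measurable g ->
  (forall t, ~ N t -> f t <= g t) -> \int[m]_t f t <= \int[m]_t g t.
Proof.
move=> mN N0 /integrable_bounded_measurable If.
move=> /integrable_bounded_measurable Ig fg.
rewrite /Rintegral (negligible_integral mN _ If)//.
rewrite (negligible_integral mN _ Ig)//.
have mTN : measurable (setT `\` N) by exact: measurableD.
apply: le_Rintegral => //.
- exact: integrableS If.
- exact: integrableS Ig.
by move=> t [_]; exact: fg.
Qed.

Lemma eq_Rintegral_off_null f g N : measurable N -> m N = 0%E ->
  bounded_measurable f -> bounded_measurable g ->
  (forall t, ~ N t -> f t = g t) -> \int[m]_t f t = \int[m]_t g t.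
Proof.
move=> mN N0 bf bg fg; apply/eqP; rewrite eq_le.
by rewrite !(le_Rintegral_off_null mN N0)// => t /fg ->.
Qed.

End BoundedIntegral.

(** * Measurability of the payoff *)

Section Measurability.
Context (R : realType) d (T : measurableType d) (P : probability T R).
Variables (M : market P) (phi : supplier -> bool).

(** Projection onto the admissible prices. Payoffs are controlled only there; composed with [clamp]
    they become bounded and measurable on the whole line. *)
Definition clamp (p : R) : R := Num.max 0 (Num.min p (price_cap M)).

Lemma clamp_itv p : 0 <= clamp p <= price_cap M.
Proof.
rewrite le_max lexx /= ge_max ge_min lexx orbT andbT.
exact/ltW/price_cap_gt0.
Qed.

Lemma clamp_id p : 0 <= p <= price_cap M -> clamp p = p.
Proof. by move=> /andP[p0 pc]; rewrite /clamp (min_idPl pc) (max_idPr p0). Qed.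

Lemma measurable_clamp : measurable_fun setT clamp.
Proof. by apply: measurable_maxr => //; exact: measurable_minr. Qed.

Lemma measurable_bid_clamp i :
  measurable_fun setT (fun p => bid_quantity M phi i (clamp p)).
Proof.
apply: nondecreasing_measurable => // p q pq.
have /andP[p0 _] := clamp_itv p; have /andP[_ qc] := clamp_itv q.
apply: bid_nondecreasing => //.
by rewrite /clamp le_max2// le_min2.
Qed.

Lemma measurable_excess i : measurable_fun setT (excess (generation M i)).
Proof.
apply: nondecreasing_measurable => // x y xy.
apply: le_trans (excess_ge (generation_ge0 M i) xy).
by rewrite lerDl mulr_ge0 ?subr_ge0// fine_ge0.
Qed.

Context d' (U : measurableType d') (p : U -> supplier -> R).
Hypothesis measurable_p : forall i, measurable_fun setT (p ^~ i).
Hypothesis p_itv : forall u i, 0 <= p u i <= price_cap M.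

Lemma measurable_revenue i (x : U -> R) : measurable_fun setT x ->
  measurable_fun setT (fun u => revenue M phi i (p u i) (x u)).
Proof.
move=> mx; have mpx : measurable_fun setT (fun u => p u i * x u).
  by apply: measurable_funM => //; exact: measurable_p.
rewrite /revenue; case: (phi i).
  apply: measurable_funB => //; apply: measurable_funM => //.
  by apply: measurable_maxr => //; exact: measurable_funB.
apply: measurable_funB => //; apply: measurable_funM => //.
exact: (measurableT_comp (@measurable_excess i)).
Qed.

Lemma measurable_purchase k i : measurable_fun setT
  (fun u => purchase M k (fun j => bid_quantity M phi j (p u j)) i).
Proof.
have mbid j : measurable_fun setT (fun u => bid_quantity M phi j (p u j)).
  (* Admissible prices are fixed by [clamp], and the clamped bid is monotone on the whole line. *)
  under eq_fun => u do rewrite -(clamp_id (p_itv u j)).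
  exact: (measurableT_comp (@measurable_bid_clamp j)).
rewrite /purchase; case: (i == k); first exact: measurable_minr.
apply: measurable_minr => //; apply: measurable_funB => //.
exact: measurable_minr.
Qed.

Lemma measurable_order_revenue k i :
  measurable_fun setT (fun u => order_revenue M phi k (p u) i).
Proof. exact/measurable_revenue/measurable_purchase. Qed.

Lemma measurable_total_revenue k :
  measurable_fun setT (fun u => total_revenue M phi k (p u)).
Proof.
under eq_fun do rewrite /total_revenue big_bool.
by apply: measurable_funD; exact: measurable_order_revenue.
Qed.

Lemma measurable_payoff i : measurable_fun setT (fun u => payoff M phi i (p u)).
Proof.
have mfirst k : measurable_fun setT (fun u => first_prob M phi (p u) k).
  have mt := measurable_total_revenue.
  rewrite /first_prob.
  apply: measurable_fun_ifT => //; first exact: measurable_fun_ltr.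
  apply: measurable_fun_ifT => //; first exact: measurable_fun_ltr.
  apply: measurable_fun_ifT => //; first exact: measurable_fun_ltr.
  by apply: measurable_fun_ifT => //; exact: measurable_fun_ltr.
under eq_fun do rewrite /payoff big_bool.
by apply: measurable_funD; apply: measurable_funM => //;
  exact: measurable_order_revenue.
Qed.

End Measurability.

(** * Expected payoff of a pure price against a mixed strategy *)

Section MeanDuel.
Context (R : realType) d (T : measurableType d) (P : probability T R).
Variables (M : market P) (phi : supplier -> bool).
Implicit Types (i : supplier) (m nu : probability R R) (x p : R).

Lemma measurable_duel i : measurable_fun [set: R * R]
  (fun z => duel M phi i (clamp M z.1) (clamp M z.2)).
Proof.
apply: (@measurable_payoff R d T P M phi _ (R * R)%type
  (fun z j => if j == i then clamp M z.1 else clamp M z.2)).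
- move=> j; case: (j == i).
    exact: (measurableT_comp (@measurable_clamp _ _ _ _ M) measurable_fst).
  exact: (measurableT_comp (@measurable_clamp _ _ _ _ M) measurable_snd).
- by move=> z j; case: (j == i); exact: clamp_itv.
Qed.

Lemma bounded_measurable_duel i x : bounded_measurable
  (fun z => duel M phi i (clamp M x) (clamp M z)).
Proof.
split.
  exact: (measurableT_comp (measurable_duel i) (measurable_pair1 x)).
exists (price_cap M * demand M) => z; rewrite ger0_norm ?duel_ge0 ?clamp_itv//.
by rewrite duel_le ?clamp_itv.
Qed.

Definition mean_duel i m x : R :=
  \int[m]_z duel M phi i (clamp M x) (clamp M z).

Lemma integral_duel i m x :
  (\int[m]_z (duel M phi i (clamp M x) (clamp M z))%:E =
   (mean_duel i m x)%:E)%E.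
Proof.
rewrite /mean_duel /Rintegral fineK//.
have bd := bounded_measurable_duel i x.
by have /integrable_fin_num := integrable_bounded_measurable m bd; apply.
Qed.

Lemma mean_duel_ge0 i m x : 0 <= mean_duel i m x.
Proof. by apply: Rintegral_ge0 => z _; rewrite duel_ge0 ?clamp_itv. Qed.

Lemma mean_duel_le i m x : mean_duel i m x <= price_cap M * demand M.
Proof.
apply: (@le_trans _ _ (\int[m]_z (price_cap M * demand M))); last first.
  by rewrite Rintegral_cst//= probability_setT mulr1.
apply: le_Rintegral => //.
- exact/integrable_bounded_measurable/bounded_measurable_duel.
- exact: finite_measure_integrable_cst.
- by move=> z _; rewrite duel_le ?clamp_itv.
Qed.

(** As a function of x it is the inner integral of Tonelli's theorem. *)
Lemma measurable_mean_duel i m : measurable_fun setT (mean_duel i m).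
Proof.
apply/measurable_EFinP.
rewrite (_ : EFin \o _ = fubini_F m
    (fun z => (duel M phi i (clamp M z.1) (clamp M z.2))%:E)); last first.
  by apply/funext => x; rewrite /fubini_F /= integral_duel.
apply: measurable_fun_fubini_tonelli_F.
  by apply/measurable_EFinP; exact: measurable_duel.
by move=> z; rewrite lee_fin duel_ge0 ?clamp_itv.
Qed.

Lemma bounded_measurable_mean_duel i m : bounded_measurable (mean_duel i m).
Proof.
split; first exact: measurable_mean_duel.
exists (price_cap M * demand M) => x.
by rewrite ger0_norm ?mean_duel_ge0// mean_duel_le.
Qed.

Lemma price_strategyC m : price_strategy M m ->
  m (~` `[0, price_cap M]%classic) = 0%E.
Proof. by move=> hm; rewrite probability_setC// hm subee. Qed.

(** Both laws are carried by the admissible prices, so the integral over the square equals that of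
    the clamped payoff over the plane, and Tonelli's theorem applies. *)
Lemma expected_revenueE i nu m : price_strategy M nu -> price_strategy M m ->
  expected_revenue M phi i nu m = (\int[nu]_x mean_duel i m x)%:E.
Proof.
move=> hnu hm; set I := `[0, price_cap M]%classic.
pose f (z : R * R) := (duel M phi i (clamp M z.1) (clamp M z.2))%:E.
have f0 z : (0 <= f z)%E by rewrite lee_fin duel_ge0 ?clamp_itv.
have mf : measurable_fun setT f.
  by apply/measurable_EFinP; exact: measurable_duel.
have mI : measurable I by exact: measurable_itv.
have mCI : measurable (~` I) by exact: measurableC.
have mII : measurable (I `*` I) by exact: measurableX.
(* The complement of the square is covered by two strips, each null for one of the marginals. *)
have null : (nu \x m)%E (~` (I `*` I)) = 0%E.
  apply/eqP; rewrite -measure_le0.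
  apply: (@le_trans _ _ ((nu \x m)%E ((~` I `*` setT) `|` (setT `*` ~` I)))).
    apply: le_measure; rewrite ?inE.
    - exact: measurableC.
    - by apply: measurableU; apply: measurableX => //; exact: measurableC.
    - by move=> [x z] /= /not_andP[] ?; [left|right].
  apply: le_trans (measureU2 _ _ _) _; try exact: measurableX.
  rewrite -[leRHS]adde0; apply: leeD; rewrite le_eqVlt; apply/predU1P; left.
    apply: etrans (product_measure1E nu m mCI measurableT) _.
    by rewrite [X in (X * _)%E](price_strategyC hnu) mul0e.
  apply: etrans (product_measure1E nu m measurableT mCI) _.
  by rewrite [X in (_ * X)%E](price_strategyC hm) mule0.
transitivity (\int[nu \x m]_(z in I `*` I) f z)%E.
  apply: eq_integral => z; rewrite inE => -[/= z1 z2].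
  by rewrite /f !clamp_id//; move: z1 z2; rewrite /I /= !in_itv.
transitivity (\int[nu \x m]_z f z)%E.
  rewrite (ge0_negligible_integral _ _ mf _ null)//; last exact: measurableC.
  by rewrite setTD setCK.
rewrite fubini_tonelli1//.
under eq_integral do rewrite /fubini_F /f /= integral_duel.
rewrite /Rintegral fineK//.
have bd := bounded_measurable_mean_duel i m.
by have /integrable_fin_num := integrable_bounded_measurable nu bd; apply.
Qed.

(** The opponent prices to be discarded: the inadmissible ones and the tie with p. *)
Definition off_market p : set R := ~` `[0, price_cap M]%classic `|` [set p].

Lemma measurable_off_market p : measurable (off_market p).
Proof. by apply: measurableU => //; exact: measurableC. Qed.

Lemma off_market_null m p : price_strategy M m -> m [set p] = 0%E ->
  m (off_market p) = 0%E.
Proof.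
move=> hm mp; apply/eqP; rewrite -measure_le0.
apply: le_trans (measureU2 _ _ _) _ => //; first exact: measurableC.
by rewrite [X in (X + _)%E](price_strategyC hm) [X in (_ + X)%E]mp adde0.
Qed.

Lemma off_marketN p z : ~ off_market p z -> 0 <= z <= price_cap M /\ z != p.
Proof.
move=> /not_orP[/contrapT]; rewrite /= in_itv /= => zI zp; split => //.
exact/eqP.
Qed.

(** Without an atom at p a tie has probability 0, so the pointwise bound [duel_undercut] can be
    integrated. *)
Lemma mean_duel_undercut i m p x : price_strategy M m -> m [set p] = 0%E ->
  0 <= p -> p < x -> x <= price_cap M ->
  mean_duel i m x <= mean_duel i m p + (x - p) * demand M.
Proof.
move=> hm mp p0 px xc.
have bd := bounded_measurable_duel i p.
have /= := Rintegral_affine m 1 ((x - p) * demand M) bd.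
rewrite mulr1 => <-.
apply: (le_Rintegral_off_null (measurable_off_market p)) => //.
- exact: off_market_null.
- exact: bounded_measurable_duel.
- exact/bounded_measurable_affine/bounded_measurable_duel.
move=> z /off_marketN[zI zp]; rewrite mulr1.
rewrite !clamp_id//; first exact: duel_undercut.
- by rewrite p0 (le_trans (ltW px)).
- by rewrite (le_trans p0 (ltW px)).
Qed.

Lemma price_cdfB m a b : a <= b ->
  price_cdf m b - price_cdf m a = fine (m `]a, b]%classic).
Proof.
move=> ab; rewrite /price_cdf.
have -> : `]-oo, b]%classic = `]-oo, a]%classic `|` `]a, b]%classic :> set R.
  by rewrite -itv_bndbnd_setU// bnd_simp.
rewrite measureU// ?fineD ?fin_num_measure//; first by rewrite addrC addKr.
apply/seteqP; split=> // x /=; rewrite !in_itv /= => -[xa /andP[/lt_geF]].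
by rewrite xa.
Qed.

(** * Indifference of the suppliers in equilibrium *)

Section Equilibrium.
Variable mu : supplier -> probability R R.
Hypothesis mu_eq : mixed_price_equilibrium M phi mu.
Notation opponent i := (mu (~~ i)).
Notation eqrev := (equilibrium_revenue M phi mu).

Let mu_strategy i : price_strategy M (mu i).
Proof. exact: mu_eq.1. Qed.

Lemma equilibrium_revenueE i :
  eqrev i = \int[mu i]_x mean_duel i (opponent i) x.
Proof. by rewrite /equilibrium_revenue expected_revenueE. Qed.

(** The Dirac mass at x is an admissible deviation. *)
Lemma mean_duel_le_equilibrium i x : 0 <= x <= price_cap M ->
  mean_duel i (opponent i) x <= eqrev i.
Proof.
move=> xI; have dirac_strategy : price_strategy M (\d_x : probability R R).
  by rewrite /price_strategy /= diracE mem_set//= in_itv.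
have := mu_eq.2 i _ dirac_strategy.
rewrite !expected_revenueE// lee_fin equilibrium_revenueE; apply: le_trans.
rewrite /Rintegral integral_dirac//.
  by rewrite diracE mem_set//= mul1r.
by apply/measurable_EFinP; exact: measurable_mean_duel.
Qed.

(* If a price p earned less than the equilibrium revenue, so would the prices
   just above it, which are played with positive probability. *)
Lemma mean_duel_equilibrium i p : 0 <= p < price_cap M ->
  opponent i [set p] = 0%E ->
  {in `]p, price_cap M], forall q, price_cdf (mu i) p < price_cdf (mu i) q} ->
  mean_duel i (opponent i) p = eqrev i.
Proof.
move=> /andP[p0 pc] atom incr; apply/eqP; rewrite eq_le.
rewrite mean_duel_le_equilibrium ?p0 ?(ltW pc)//= leNgt; apply/negP => gap.
set W := mean_duel i (opponent i) in gap *.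
(* With eta half the gap and (q - p) * demand <= eta, undercutting shows that every price in ]p, q]
   earns at most the equilibrium revenue minus eta. *)
pose eta := (eqrev i - W p) / 2.
have eta0 : 0 < eta by rewrite divr_gt0 ?subr_gt0.
pose q := Num.min (price_cap M) (p + eta / demand M).
have pq : p < q by rewrite lt_min pc ltrDl divr_gt0 ?demand_gt0.
have qc : q <= price_cap M by rewrite ge_min lexx.
have qp_eta : (q - p) * demand M <= eta.
  rewrite -ler_pdivlMr ?demand_gt0// lerBlDl.
  by rewrite ge_min lexx orbT.
(* Integrated against the own strategy of i, this makes eta times the mass of ]p, q] nonpositive,
   against [incr]. The terms with 0 give the integrands the shape of [Rintegral_affine]. *)
have : \int[mu i]_x (W x + (\1_(`]p, q]%classic) x * eta + 0))
    <= \int[mu i]_x (W x * 0 + eqrev i).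
  have bW : bounded_measurable W by exact: bounded_measurable_mean_duel.
  apply: (le_Rintegral_off_null (N := ~` `[0, price_cap M]%classic)).
  - exact: measurableC.
  - exact: price_strategyC.
  - apply: bounded_measurableD => //.
    exact/bounded_measurable_affine/bounded_measurable_indic.
  - exact: bounded_measurable_affine.
  move=> x /contrapT /=; rewrite in_itv /= => xI.
  have Wx := mean_duel_le_equilibrium i xI.
  rewrite mulr0 add0r addr0 indicE; have [|] := boolP (x \in _).
    rewrite inE /= in_itv /= => /andP[px xq].
    have Wxp := mean_duel_undercut i (mu_strategy (~~ i)) atom p0 px
      (le_trans xq qc).
    rewrite -/W in Wxp.
    have : (x - p) * demand M <= (q - p) * demand M.
      by rewrite ler_wpM2r ?lerD2r// ltW ?demand_gt0.
    have : eta *+ 2 = eqrev i - W p by rewrite -mulr_natr divfK.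
    rewrite mul1r; lra.
  by rewrite mul0r addr0.
have bW : bounded_measurable W by exact: bounded_measurable_mean_duel.
rewrite Rintegral_add//; last first.
  exact/bounded_measurable_affine/bounded_measurable_indic.
rewrite !Rintegral_affine//; last exact: bounded_measurable_indic.
rewrite Rintegral_indic// -equilibrium_revenueE mulr0 add0r addr0 gerDl.
rewrite -price_cdfB ?(ltW pq)// pmulr_lle0// subr_le0 leNgt incr//.
by rewrite in_itv /= pq.
Qed.

End Equilibrium.
End MeanDuel.

(** * From two-sided increment bounds to a derivative and an integral formula *)

Section IncrementBounds.
Context (R : realType) (l c C : R) (N k : R -> R).
Hypotheses (l_gt0 : 0 < l) (C_ge0 : 0 <= C).
Hypothesis k_gt0 : forall q, l < q < c -> 0 < k q.
Hypothesis k_continuous : forall q, l < q < c -> {for q, continuous k}.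
Hypothesis N_increment : forall a b, l < a -> a < b -> b < c ->
  k a * (N b - N a) <= C / a - C / b <= k b * (N b - N a).

Let f q := C / (q ^+ 2 * k q).

(** The increment bounds are divided by b - a, using C / a - C / b = (b - a) * (C / (a * b)). *)
Lemma slope_bounds a b : l < a -> a < b -> b < c ->
  C / (a * b * k b) <= (N b - N a) / (b - a) <= C / (a * b * k a).
Proof.
move=> la ab bc; have a0 := lt_trans l_gt0 la; have b0 := lt_trans a0 ab.
have ka : 0 < k a by rewrite k_gt0// la (lt_trans ab).
have kb : 0 < k b by rewrite k_gt0// bc (lt_trans la).
have ba : 0 < b - a by rewrite subr_gt0.
have CE : C / a - C / b = (b - a) * (C / (a * b)).
  by field; rewrite !gt_eqF.
have := N_increment la ab bc; rewrite CE => /andP[le1 le2].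
rewrite ![_ * _ * k _]mulrC !invfM.
apply/andP; split.
  rewrite ler_pdivlMr// -(ler_pM2l kb); apply: le_trans le2.
  by rewrite le_eqVlt; apply/predU1P; left; field; rewrite !gt_eqF.
rewrite ler_pdivrMr// -(ler_pM2l ka); apply: le_trans le1 _.
by rewrite le_eqVlt; apply/predU1P; left; field; rewrite !gt_eqF.
Qed.

Lemma is_derive_increment q : l < q < c -> is_derive q 1 N (f q).
Proof.
move=> qlc; have /andP[lq qc] := qlc.
have q0 : 0 < q := lt_trans l_gt0 lq.
have kq := k_gt0 qlc.
(* These are the two slope bounds for the points q and h + q. For h < 0 the lower one is [phi1], for
   h > 0 it is [phi2]. *)
pose phi1 h := C / (q * (h + q) * k q).
pose phi2 h := C / (q * (h + q) * k (h + q)).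
have shift0 : (h + q) @[h --> 0^'] --> q.
  rewrite -[X in _ --> X]add0r; apply: cvgD; last exact: cvg_cst.
  exact: nbhs_dnbhs.
have kshift : k (h + q) @[h --> 0^'] --> k q.
  exact: (continuous_cvg _ (k_continuous qlc) shift0).
have cvg1 : phi1 h @[h --> 0^'] --> f q.
  rewrite /f expr2; apply: cvgMr; apply: cvgV.
    by rewrite !mulf_neq0 ?gt_eqF.
  by apply: cvgMl; apply: cvgMr.
have cvg2 : phi2 h @[h --> 0^'] --> f q.
  rewrite /f expr2; apply: cvgMr; apply: cvgV.
    by rewrite !mulf_neq0 ?gt_eqF.
  by apply: cvgM => //; apply: cvgMr.
have cvg12 : `|phi2 h - phi1 h| @[h --> 0^'] --> (0 : R).
  by have := cvg_norm (cvgB cvg2 cvg1); rewrite subrr normr0; exact.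
have slope : h^-1 * (N (h + q) - N q) @[h --> 0^'] --> f q.
  (* This symmetric envelope contains the slope for both signs of h, so a single squeeze gives the
     two-sided limit. *)
  apply: (@squeeze_cvgr _ _ _ _ (fun h => phi1 h - `|phi2 h - phi1 h|)
    (fun h => phi1 h + `|phi2 h - phi1 h|)).
  - near=> h.
    have h0 : h != 0 by near: h; exact: nbhs_dnbhs_neq.
    have hl : l < h + q by near: h; apply: (cvgr_gt q shift0).
    have hc : h + q < c by near: h; apply: (cvgr_lt q shift0).
    have : (phi1 h <= h^-1 * (N (h + q) - N q) <= phi2 h) ||
           (phi2 h <= h^-1 * (N (h + q) - N q) <= phi1 h).
      rewrite /phi1 /phi2; case: (ltgtP h 0) h0 => // hh _.
        have := @slope_bounds (h + q) q hl _ qc; rewrite gtrDr => /(_ hh).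
        rewrite [_ * q]mulrC (_ : (N q - N (h + q)) / (q - (h + q)) =
            h^-1 * (N (h + q) - N q)).
          by move=> ->.
        by rewrite opprD addrCA subrr addr0 invrN mulrN -mulNr opprB mulrC.
      have := @slope_bounds q (h + q) lq _ hc; rewrite ltrDr => /(_ hh).
      rewrite (_ : (N (h + q) - N q) / (h + q - q) = h^-1 * (N (h + q) - N q)).
        by move=> ->; rewrite orbT.
      by rewrite addrK mulrC.
    by move=> /orP[] /andP[? ?]; case: (ger0P (phi2 h - phi1 h)); lra.
  - by rewrite -[X in _ --> X]subr0; exact: cvgB.
  - by rewrite -[X in _ --> X]addr0; exact: cvgD.
have E : (fun h : R => h^-1 *: (N (h *: (1:R) + q) - N q)) =
         (fun h => h^-1 * (N (h + q) - N q)).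
  by apply/funext => h; rewrite [h *: _]mulr1.
apply: DeriveDef.
  by rewrite /derivable; apply/cvg_ex; exists (f q); rewrite /= E.
by rewrite /derive /= E; exact/cvg_lim.
Unshelve. all: by end_near. Qed.

Lemma density_continuous q : l < q < c -> {for q, continuous f}.
Proof.
move=> qlc; have q0 : 0 < q by case/andP: qlc => + _; exact: lt_trans.
apply: cvgMr; apply: cvgV; first by rewrite mulf_neq0 ?expf_neq0 ?gt_eqF ?k_gt0.
apply: cvgM; last exact: k_continuous.
exact: exprn_continuous.
Qed.

(** On a compact interval inside ]l, c[, N is an antiderivative of the continuous f. *)
Lemma increment_integral a b : l < a -> a < b -> b < c ->
  (\int[lebesgue_measure]_(q in `[a, b]) (f q)%:E = (N b)%:E - (N a)%:E)%E.
Proof.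
move=> la ab bc.
have sub q : q \in `[a, b] -> l < q < c.
  by rewrite in_itv /= => /andP[/(lt_le_trans la) -> /le_lt_trans ->].
have dN q : l < q < c -> derivable N q 1.
  by move=> /is_derive_increment[].
have cN q : l < q < c -> {for q, continuous N}.
  by move=> /dN/derivable1_diffP/differentiable_continuous.
apply: continuous_FTC2 => //.
- apply: continuous_in_subspaceT => q; rewrite inE => /sub.
  exact: density_continuous.
- split.
  + by move=> q qab; apply/dN/sub; exact: subset_itv_oo_cc.
  + by apply/cvg_at_right_filter/cN/sub; rewrite in_itv /= lexx ltW.
  + by apply/cvg_at_left_filter/cN/sub; rewrite in_itv /= lexx ltW.
move=> q qab; have /is_derive_increment qD : l < q < c.
  by apply: sub; exact: subset_itv_oo_cc.
by rewrite derive1E; exact: derive_val.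
Qed.

Hypothesis N_right : N x @[x --> l^'+] --> 0.

(** The increment bounds stop short of l. The formula on [a, p] is passed to the limit as a
    decreases to l: monotone convergence handles the integral, and N(a) tends to 0. *)
Lemma integral_from_left_end p : l < p -> p < c ->
  (\int[lebesgue_measure]_(q in `[l, p]) (f q)%:E = (N p)%:E)%E.
Proof.
move=> lp pc.
have mf : measurable_fun (`]l, p] : set R) (EFin \o f).
  apply/measurable_EFinP; apply: (measurable_funS (E := `]l, c[)) => //.
    by apply: subset_itvl; rewrite bnd_simp.
  apply: open_continuous_measurable_fun; first exact: interval_open.
  by move=> q; rewrite inE /= in_itv /=; exact: density_continuous.
rewrite -integral_itv_obnd_cbnd//.
(* The denominator n + 2 keeps even the first term strictly below p. *)
pose a n : R := l + (p - l) / n.+2%:R.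
have lp0 : 0 < p - l by rewrite subr_gt0.
have la n : l < a n by rewrite ltrDl divr_gt0// ltr0n.
have ap n : a n < p.
  by rewrite -ltrBrDl ltr_pdivrMr ?ltr0n// ltr_pMr// ltr1n.
have a_cvg : a n @[n --> \oo] --> l.
  rewrite -[X in _ --> X]addr0; apply: cvgD; first exact: cvg_cst.
  rewrite -(mulr0 (p - l)); apply: cvgMr.
  have := @cvg_harmonic R; rewrite -(cvg_shiftS (@harmonic R)); exact.
have a_dec m n : (m <= n)%N -> a n <= a m.
  move=> mn; rewrite lerD2l ler_wpM2l ?(ltW lp0)//.
  by rewrite lef_pV2 ?posrE ?ltr0n// ler_nat.
have cupE : \bigcup_n `[a n, p]%classic = `]l, p]%classic.
  apply/seteqP; split => q /=.
    move=> [n _] /=; rewrite !in_itv /=.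
    by move=> /andP[/(lt_le_trans (la n)) -> ->].
  rewrite in_itv /= => /andP[lq qp].
  have [n _ /(_ n) nq] := cvgr_lt l a_cvg q lq.
  by exists n => //=; rewrite in_itv /= qp andbT ltW// nq //=.
rewrite -cupE.
have cvg_int : (\int[lebesgue_measure]_(q in `[a n, p]) (f q)%:E)%E @[n --> \oo]
    --> (\int[lebesgue_measure]_(q in \bigcup_n `[a n, p]%classic) (f q)%:E)%E.
  apply: ge0_nondecreasing_set_cvg_integral.
  - move=> m n mn; apply/subsetPset => q /=; rewrite !in_itv /= => /andP[aq ->].
    by rewrite (le_trans (a_dec _ _ mn) aq).
  - by move=> n; exact: measurable_itv.
  - move=> n; apply: measurable_funS mf => // q /=.
    by rewrite !in_itv /= => /andP[/(lt_le_trans (la n)) -> ->].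
  - move=> n q /=; rewrite in_itv /= => /andP[aq qp]; rewrite lee_fin.
    have lq : l < q := lt_le_trans (la n) aq.
    rewrite divr_ge0// mulr_ge0 ?sqr_ge0// ltW// k_gt0// lq.
    exact: le_lt_trans pc.
have intE n : (\int[lebesgue_measure]_(q in `[a n, p]) (f q)%:E =
    (N p - N (a n))%:E)%E.
  exact: increment_integral.
apply: (cvg_unique _ cvg_int) => //=; rewrite (eq_cvg _ _ intE).
apply: cvg_EFin; first by near=> n.
rewrite -[X in _ --> X]subr0; apply: cvgB; first exact: cvg_cst.
by have /cvg_at_rightP := N_right; apply; split.
Unshelve. all: by end_near. Qed.

End IncrementBounds.

(** * Right continuity of a price CDF and its value at the lower support *)

Section PriceCdf.
Context (R : realType) (m : probability R R).

Lemma price_cdf_right_continuous x :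
  price_cdf m y @[y --> x^'+] --> price_cdf m x.
Proof.
(* The identity, as a random variable under m, has [price_cdf m] as its CDF. *)
pose X : {RV m >-> R} := mfun_Sub (mem_set (@measurable_id _ R setT)).
suff /fine_cvg : cdf X y @[y --> x^'+] --> (price_cdf m x)%:E by [].
rewrite /price_cdf fineK ?fin_num_measure//.
exact: cdf_right_continuous.
Qed.

(** The half-line up to l is {l}, which has no mass, together with countably many half-lines ending
    before l, which are null by the definition of l. *)
Lemma price_cdf_lower_support l : lower_support m = l -> 0 < l ->
  m [set l] = 0%E -> price_cdf m l = 0.
Proof.
move=> lE l0 atom.
have below x : x < l -> m `]-oo, x]%classic = 0%E.
  rewrite -lE => /sup_gt[]; last first.
    move=> y /= y0 xy; apply/eqP; rewrite -measure_le0.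
    have <- : m `]-oo, y]%classic = 0%E.
      by apply/eqP; rewrite -fine_eq0 ?fin_num_measure//; apply/eqP.
    apply: le_measure; rewrite ?inE//; apply: subset_itvl.
    by rewrite bnd_simp ltW.
  (* If the CDF vanished nowhere, l would be the supremum of the empty set, which is 0 by
     convention, against 0 < l. *)
  apply/set0P/negP => /eqP S0; move: lE l0; rewrite /lower_support S0 sup0.
  by move=> <-; rewrite ltxx.
have : m `]-oo, l]%classic = 0%E.
  apply/eqP; rewrite -measure_le0.
  have -> : `]-oo, l]%classic =
      \bigcup_n `]-oo, l - n.+1%:R^-1]%classic `|` [set l] :> set R.
    apply/seteqP; split => x /=.
      rewrite in_itv /= le_eqVlt => /predU1P[->|xl]; [by right|left].
      have [n ln] := ltr_add_invr xl.
      by exists n => //=; rewrite in_itv /= lerBrDr ltW.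
    move=> [[n _]|->]; rewrite /= in_itv //=.
    by move/le_trans; apply; rewrite gerBl.
  have mU : measurable (\bigcup_n `]-oo, l - n.+1%:R^-1]%classic : set R).
    by apply: bigcup_measurable.
  apply: le_trans (measureU2 _ mU _) _ => //.
  rewrite [X in (_ + X)%E]atom adde0.
  have : m.-negligible (\bigcup_n `]-oo, l - n.+1%:R^-1]%classic).
    apply: negligible_bigcup => n; apply/negligibleP => //.
    by apply: below; rewrite gtrBl invr_gt0.
  by move/negligibleP => /(_ mU) ->.
by rewrite /price_cdf => ->.
Qed.

End PriceCdf.

(** * Continuity of the bid in the price *)

Section Continuity.
Context (R : realType) d (T : measurableType d) (P : probability T R).
Variables (M : market P) (phi : supplier -> bool).

(** An increasing function that reaches all intermediate values has no jump; the value y is reached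
    at the CDF of y. *)
Lemma inv_cdf_continuous i : {in `]0, 1[, continuous (inv_cdf M i)}.
Proof.
suff : {within `[0, 1], continuous (inv_cdf M i)}.
  by move/(continuous_within_itvP _ ltr01) => [].
apply: segment_inc_surj_continuous.
  exact/le_mono_in/inv_cdf_incr.
move=> y /=; rewrite in_itv /= inv_cdf0 => /andP[y0 y1].
have yI : y \in `[0, max_generation M i].
  have /(inv_cdf_itv M i) : (1 : R) \in `[0, 1] by rewrite in_itv /= ler01 lexx.
  by rewrite !in_itv /= y0 => /andP[_]; exact: le_trans.
exists (fine (cdf (generation M i) y)); last exact: gen_cdfK yI.
rewrite in_itv /= fine_ge0//=.
by rewrite -lee_fin fineK ?fin_num_measure// cdf_le1.
Qed.

Lemma bid_continuous i q : phi i = false -> 0 < q < price_cap M ->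
  {for q, continuous (bid_quantity M phi i)}.
Proof.
move=> phii /andP[q0 qc].
have -> : bid_quantity M phi i = inv_cdf M i \o (fun p => p / penalty M).
  by apply/funext => p; rewrite /bid_quantity phii.
apply: continuous_comp; first exact: mulrr_continuous.
apply: inv_cdf_continuous; rewrite in_itv /= divr_gt0 ?penalty_gt0//=.
rewrite ltr_pdivrMr ?penalty_gt0// mul1r.
exact: lt_trans qc (price_cap_lt_penalty M).
Qed.

End Continuity.

(** * The two equilibrium CDFs, s being the supplier with storage and n the one without *)

Section Subgame.
Context (R : realType) d (T : measurableType d) (P : probability T R).
Variables (M : market P) (phi : supplier -> bool).
Variables (s n : supplier).
Hypotheses (phis : phi s = true) (phin : phi n = false).
Hypotheses (sn : s = ~~ n) (ns : n = ~~ s).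
Notation D := (demand M).
Notation E := (mean_generation M s).
Notation bid := (bid_quantity M phi n).
Implicit Type m : probability R R.

Let D0 : 0 < D := demand_gt0 M.

Lemma residual_demand_stored p : residual_demand M phi s p = Num.max (D - E) 0.
Proof.
rewrite /residual_demand /bid_quantity phis.
by case: (leP D E) => DE; case: (leP (D - E) 0) => DE0; lra.
Qed.

(** What s leaves does not depend on his price. So n earns one of two amounts at p, and is served
    second with probability [price_cdf m p]. *)
Lemma mean_duel_unstored m p : price_strategy M m -> m [set p] = 0%E ->
  0 <= p <= price_cap M ->
  mean_duel M phi n m p = capped_revenue M phi n p D -
    (capped_revenue M phi n p D - capped_revenue M phi n p (Num.max (D - E) 0))
    * price_cdf m p.
Proof.
move=> hm mp pI; set A := capped_revenue _ _ _ _ D.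
set B := capped_revenue _ _ _ _ _.
transitivity (\int[m]_z (\1_(`]-oo, p]%classic) z * (B - A) + A)).
  apply: (eq_Rintegral_off_null (measurable_off_market M p)).
  - exact: off_market_null.
  - exact: bounded_measurable_duel.
  - exact/bounded_measurable_affine/bounded_measurable_indic.
  move=> z /off_marketN[zI zp]; rewrite !clamp_id// indicE.
  have [zltp|pz|/eqP] := ltgtP z p; last by rewrite (negbTE zp).
    rewrite mem_set ?mul1r ?subrK/= ?in_itv/= ?ltW// duel_gt//.
    by rewrite -sn residual_demand_stored.
  rewrite memNset ?mul0r ?add0r ?duel_lt//= in_itv /=.
  by apply/negP; rewrite -ltNge.
rewrite Rintegral_affine; last exact: bounded_measurable_indic.
rewrite Rintegral_indic// -/(price_cdf m p); lra.
Qed.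

(** Sale of s when served first minus his sale when n is served before him at the price p. *)
Definition displaced_demand p : R :=
  Num.min D E - Num.min (residual_demand M phi n p) E.

Lemma displaced_demand_nondecreasing p q : 0 <= p -> q <= price_cap M ->
  p <= q -> displaced_demand p <= displaced_demand q.
Proof.
move=> p0 qc pq; have bpq := bid_nondecreasing phi n p0 qc pq.
by rewrite lerB// le_min2// lerB// le_min2.
Qed.

(** The condition makes the demand left by n at most min(D, E), so s would sell all of it. *)
Lemma displaced_demandE p : Num.max (D - E) 0 <= Num.min (bid p) D ->
  displaced_demand p = Num.min (bid p) D - Num.max (D - E) 0.
Proof.
have := mean_generation_ge0 M s; rewrite /displaced_demand /residual_demand.
rewrite (minC (bid p)); case: (leP D (bid p)) => h1;
  case: (leP (D - E) 0) => h2;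
  by case: (leP D E) => h3; rewrite minEle; case: ifPn; rewrite -?ltNge; lra.
Qed.

(** The revenue of s divided by his price is his sale. The sales at a and at b differ only if n
    prices at some z in ]a, b], and then by the displaced demand at z, which is monotone in z. *)
Lemma mean_duel_stored_increment m a b : price_strategy M m ->
  m [set a] = 0%E -> m [set b] = 0%E -> 0 < a -> a < b -> b <= price_cap M ->
  displaced_demand a * (price_cdf m b - price_cdf m a)
  <= mean_duel M phi s m a / a - mean_duel M phi s m b / b
  <= displaced_demand b * (price_cdf m b - price_cdf m a).
Proof.
move=> hm ma mb a0 ab bc; have b0 := lt_trans a0 ab.
have aI : 0 <= a <= price_cap M by rewrite (ltW a0) (le_trans (ltW ab)).
have bI : 0 <= b <= price_cap M by rewrite (ltW b0).
pose N := off_market M a `|` off_market M b.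
have mOff := measurable_off_market M.
have mN : measurable N by exact: measurableU.
have N0 : m N = 0%E.
  apply/eqP; rewrite -measure_le0.
  apply: le_trans (measureU2 _ (mOff a) (mOff b)) _.
  rewrite [X in (X + _)%E](off_market_null hm ma).
  by rewrite [X in (_ + X)%E](off_market_null hm mb) adde0.
have pointwise z : ~ N z ->
    let inc := duel M phi s a z / a - duel M phi s b z / b in
    displaced_demand a * \1_(`]a, b]%classic) z <= inc
      <= displaced_demand b * \1_(`]a, b]%classic) z.
  move=> /not_orP[/off_marketN[zI /eqP za] /off_marketN[_ /eqP zb]] /=.
  have [z0 zc] := andP zI.
  have firstE x : x < z -> 0 < x -> duel M phi s x z / x = Num.min D E.
    move=> xz x0; rewrite duel_lt// capped_revenue_stored//.
    by rewrite mulrAC divff ?mul1r ?gt_eqF.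
  have secondE x : z < x -> 0 < x ->
      duel M phi s x z / x = Num.min (residual_demand M phi n z) E.
    move=> zx x0; rewrite duel_gt// -ns capped_revenue_stored//.
    by rewrite mulrAC divff ?mul1r ?gt_eqF.
  rewrite indicE; have [zlta|az|//] := ltgtP z a.
    rewrite memNset /= ?in_itv/=; last by rewrite (lt_gtF zlta).
    rewrite (secondE a)// (secondE b) ?(lt_trans zlta ab)//.
    by rewrite subrr !mulr0 lexx.
  have [zltb|bz|//] := ltgtP z b; last first.
    rewrite memNset /= ?in_itv/=; last by rewrite az /= leNgt bz.
    by rewrite (firstE a)// (firstE b)// subrr !mulr0 lexx.
  rewrite mem_set /=; last by rewrite in_itv /= az ltW.
  rewrite !mulr1 firstE// secondE//.
  rewrite -/(displaced_demand z) !displaced_demand_nondecreasing//; exact/ltW.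
have bd x : bounded_measurable (fun z => duel M phi s (clamp M x) (clamp M z)).
  exact: bounded_measurable_duel.
have bi : bounded_measurable (\1_(`]a, b]%classic) : R -> R).
  exact: bounded_measurable_indic.
(* The constant c will be the displaced demand at a for the lower bound and at b for the upper
   one. *)
have intE c : \int[m]_z ((duel M phi s (clamp M b) (clamp M z) / b + 0) +
      (\1_(`]a, b]%classic) z * c + 0)) =
    mean_duel M phi s m b / b + c * (price_cdf m b - price_cdf m a).
  rewrite Rintegral_add; try exact: bounded_measurable_affine.
  rewrite !Rintegral_affine// Rintegral_indic// -price_cdfB ?ltW//.
  by rewrite !addr0 [c * _]mulrC.
have intaE : \int[m]_z (duel M phi s (clamp M a) (clamp M z) / a + 0) =
    mean_duel M phi s m a / a.
  by rewrite Rintegral_affine// addr0.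
have bsum c : bounded_measurable (fun z =>
    (duel M phi s (clamp M b) (clamp M z) / b + 0) +
    (\1_(`]a, b]%classic) z * c + 0)).
  by apply: bounded_measurableD; exact: bounded_measurable_affine.
apply/andP; split.
  rewrite lerBrDl -intE -intaE.
  apply: (le_Rintegral_off_null mN N0) => //.
    exact: bounded_measurable_affine.
  move=> z Nz; have [zI _] := off_marketN (fun h => Nz (or_introl h)).
  by rewrite !clamp_id//; have /andP[+ _] := pointwise z Nz; lra.
rewrite lerBlDl -intE -intaE.
apply: (le_Rintegral_off_null mN N0) => //.
  exact: bounded_measurable_affine.
move=> z Nz; have [zI _] := off_marketN (fun h => Nz (or_introl h)).
by rewrite !clamp_id//; have /andP[_] := pointwise z Nz; lra.
Qed.

Variables (mu : supplier -> probability R R) (l : R).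
Hypothesis mu_eq : mixed_price_equilibrium M phi mu.
Hypothesis lower_l : forall i, lower_support (mu i) = l.
Hypothesis l_gt0 : 0 < l.
Hypothesis eq_revenue : forall i, equilibrium_revenue M phi mu i =
  revenue M phi i l (Num.min D (bid_quantity M phi i l)).
Hypothesis cdf_incr : forall i, {in `[l, price_cap M] &,
  {homo price_cdf (mu i) : p q / p < q}}.
Hypothesis no_atom : forall i p, l <= p < price_cap M -> mu i [set p] = 0%E.
Notation eqrev := (equilibrium_revenue M phi mu).
Notation first_revenue p := (capped_revenue M phi n p D).
Notation second_revenue p := (capped_revenue M phi n p (Num.max (D - E) 0)).

Let support_market p : l <= p < price_cap M -> 0 <= p <= price_cap M.
Proof. by move=> /andP[lp pc]; rewrite (le_trans (ltW l_gt0) lp) ltW. Qed.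

Let mean_duel_support i p : l <= p < price_cap M ->
  mean_duel M phi i (mu (~~ i)) p = eqrev i.
Proof.
move=> lpc; have /andP[lp pc] := lpc.
apply: mean_duel_equilibrium => //.
- by rewrite (le_trans (ltW l_gt0) lp).
- exact: no_atom.
move=> q; rewrite in_itv /= => /andP[pq qc].
by apply: cdf_incr; rewrite ?in_itv //= ?lp ?(ltW pc)// qc (le_trans lp)// ltW.
Qed.

(** The equilibrium revenue of n is the revenue of the first served at l. *)
Lemma first_revenue_gt p : l < p < price_cap M -> eqrev n < first_revenue p.
Proof.
move=> /andP[lp pc]; rewrite eq_revenue.
by apply: capped_revenue_incr => //; exact: ltW.
Qed.

Lemma stored_cdf_eq p : l <= p < price_cap M -> eqrev n =
  first_revenue p - (first_revenue p - second_revenue p) * price_cdf (mu s) p.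
Proof.
move=> lpc; rewrite -(mean_duel_support n lpc) -sn.
apply: mean_duel_unstored.
- exact: mu_eq.1.
- exact: no_atom.
- exact: support_market.
Qed.

(* Otherwise the supplier without storage would earn the revenue of the first
   served, which increases with the price, on the whole support. *)
Lemma first_second_revenue_neq p : l < p < price_cap M ->
  first_revenue p - second_revenue p != 0.
Proof.
move=> lpc; apply/eqP => AB0; have /andP[lp pc] := lpc.
have := first_revenue_gt lpc; rewrite (@stored_cdf_eq p) ?pc ?ltW//.
by rewrite AB0 mul0r subr0 ltxx.
Qed.

(** Otherwise n would sell the same quantity served first or second, and the two revenues would
    coincide. *)
Lemma residual_lt_sale p : l < p < price_cap M ->
  Num.max (D - E) 0 < Num.min (bid p) D.
Proof.
move=> lpc; rewrite ltNge; apply/negP => le_sale.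
have := first_second_revenue_neq lpc.
rewrite /capped_revenue.
suff -> : Num.min (Num.max (D - E) 0) (bid p) = Num.min D (bid p).
  by rewrite subrr eqxx.
have maxD : Num.max (D - E) 0 <= D.
  by rewrite ge_max (ltW D0) andbT gerBl mean_generation_ge0.
apply/eqP; rewrite eq_le; apply/andP; split; first by rewrite le_min2.
by rewrite le_min [Num.min D _]minC le_sale ge_min lexx.
Qed.

Lemma stored_price_cdf p : l <= p < price_cap M ->
  price_cdf (mu s) p =
  (revenue M phi n p (Num.min (bid p) D) - eqrev n) /
  (revenue M phi n p (Num.min (bid p) D)
   - revenue M phi n p (Num.max (D - E) 0)).
Proof.
move=> lpc; rewrite [Num.min (bid p) D]minC.
(* At l the numerator vanishes, so the quotient is 0 whatever its denominator, and so is the CDF. *)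
have /andP[] := lpc; rewrite le_eqVlt => /predU1P[<- lc|lp pc].
  rewrite -eq_revenue subrr mul0r; apply: price_cdf_lower_support => //.
  by apply: no_atom; rewrite lexx.
have lpc' : l < p < price_cap M by rewrite lp.
have := first_second_revenue_neq lpc'; have := stored_cdf_eq lpc.
(* The residual demand is below the bid of n, so the cap is not active. *)
have -> : second_revenue p = revenue M phi n p (Num.max (D - E) 0).
  rewrite /capped_revenue (min_idPl _)//.
  by have := residual_lt_sale lpc'; rewrite lt_min => /andP[/ltW].
rewrite -/(capped_revenue M phi n p D) => eqn AB.
by apply: (mulIf AB); rewrite divfK// eqn; lra.
Qed.

(** Indifference of s replaces both mean payoffs in [mean_duel_stored_increment] by his equilibrium
    revenue, which yields the increment bounds for the CDF of n. *)
Lemma unstored_price_cdf p : l <= p < price_cap M ->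
  ((price_cdf (mu n) p)%:E = \int[lebesgue_measure]_(q in `[l, p])
     (eqrev s /
      (q ^+ 2 * Num.min (bid q) D - q ^+ 2 * Num.max (D - E) 0))%:E)%E.
Proof.
move=> lpc; have lc : l <= l < price_cap M.
  by rewrite lexx; case/andP: lpc; exact: le_lt_trans.
have cdf_l : price_cdf (mu n) l = 0.
  by apply: price_cdf_lower_support => //; exact: no_atom.
have /andP[] := lpc; rewrite le_eqVlt => /predU1P[<- _|lp pc].
  by rewrite set_itv1 integral_set1 cdf_l.
have eqrev_ge0 : 0 <= eqrev s.
  by rewrite -(mean_duel_support s lc) mean_duel_ge0.
pose k q := Num.min (bid q) D - Num.max (D - E) 0.
have kE q : q ^+ 2 * Num.min (bid q) D - q ^+ 2 * Num.max (D - E) 0 =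
    q ^+ 2 * k q.
  by rewrite mulrBr.
under eq_integral do rewrite kE.
apply/esym/(@integral_from_left_end _ l (price_cap M)) => //.
- by move=> q lq; rewrite subr_gt0; exact: residual_lt_sale.
- move=> q /andP[lq qc]; apply: cvgB; last exact: cvg_cst.
  apply: continuous_min; last exact: cvg_cst.
  by apply: bid_continuous; rewrite // (lt_trans l_gt0 lq).
- move=> a b la ab bc.
  have lb := lt_trans la ab; have ac := lt_trans ab bc.
  have kd q : l < q -> q < price_cap M -> k q = displaced_demand q.
    by move=> lq qc; rewrite displaced_demandE// ltW// residual_lt_sale// lq.
  have laI : l <= a < price_cap M by rewrite ltW.
  have lbI : l <= b < price_cap M by rewrite ltW.
  have Wa : mean_duel M phi s (mu n) a = eqrev s.
    by rewrite -(mean_duel_support s laI) -ns.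
  have Wb : mean_duel M phi s (mu n) b = eqrev s.
    by rewrite -(mean_duel_support s lbI) -ns.
  rewrite !kd// -[X in X / a]Wa -[X in X / b]Wb.
  apply: mean_duel_stored_increment => //.
  + exact: mu_eq.1.
  + exact: no_atom.
  + exact: no_atom.
  + exact: lt_trans la.
  + exact: ltW.
(* The CDF of n vanishes at l, so right continuity gives the limit 0. *)
- by rewrite -cdf_l; exact: price_cdf_right_continuous.
Qed.

End Subgame.

Theorem theorem2 (R : realType) (d : measure_display) (T : measurableType d)
    (P : probability T R) (M : market P) (phi : supplier -> bool)
    (mu : supplier -> probability R R) (l : R)
    (one_storage : (phi false + phi true = 1)%N)
    (demand_lt : demand M < \sum_(i : supplier) bid_quantity M phi i (price_cap M))
    (mu_eq : mixed_price_equilibrium M phi mu)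
    (lower_l : forall i, lower_support (mu i) = l)
    (l_gt0 : 0 < l)
    (upper_cap : forall i, upper_support (mu i) = price_cap M)
    (eq_revenue : forall i, equilibrium_revenue M phi mu i =
       revenue M phi i l (Num.min (demand M) (bid_quantity M phi i l)))
    (cdf_incr : forall i, {in `[l, price_cap M] &,
       {homo price_cdf (mu i) : p q / p < q}})
    (no_atom : forall i p, l <= p < price_cap M -> mu i [set p] = 0%E)
    (cap_atom : ~ (forall i, mu i [set price_cap M] != 0%E)) :
  forall (i : supplier) (p : R), l <= p < price_cap M ->
    (phi i = true ->
       price_cdf (mu i) p =
       (revenue M phi (~~ i) p
          (Num.min (bid_quantity M phi (~~ i) p) (demand M))
        - equilibrium_revenue M phi mu (~~ i)) /
       (revenue M phi (~~ i) p
          (Num.min (bid_quantity M phi (~~ i) p) (demand M))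
        - revenue M phi (~~ i) p
            (Num.max (demand M - mean_generation M i) 0))) /\
    (phi i = false ->
       (price_cdf (mu i) p)%:E =
       (\int[lebesgue_measure]_(q in `[l, p])
          (equilibrium_revenue M phi mu (~~ i) /
           (q ^+ 2 * Num.min (bid_quantity M phi i q) (demand M)
            - q ^+ 2 * Num.max (demand M - mean_generation M (~~ i)) 0))%:E)%E).
Proof.
move=> i p lpc; split=> phii.
  have phiN : phi (~~ i) = false.
    by move: one_storage phii; case: i => /=; do 2 case: (phi _).
  by apply: stored_price_cdf; rewrite ?negbK.
have phiN : phi (~~ i) = true.
  by move: one_storage phii; case: i => /=; do 2 case: (phi _).
by apply: unstored_price_cdf; rewrite ?negbK.
Qed.
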